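(* For every $d\ge 3$, $\dim(Q_d)=\mathrm{mdim}(Q_d)$.
   Context: The hypercube $Q_d$ has vertex set $\{0,1\}^d$, two vertices adjacent iff they differ in exactly one coordinate; distance $d(u,v)$ is the number of differing coordinates. For a vertex $x$ and an edge $uv$, $d(uv,x)=\min\{d(u,x),d(v,x)\}$. A vertex $x$ distinguishes two elements $a,b\in V\cup E$ (vertices or edges) if $d(a,x)\ne d(b,x)$. A set $S$ of vertices is a metric generator if every two distinct vertices are distinguished by some element of $S$, and a mixed metric generator if every two distinct elements of $V(Q_d)\cup E(Q_d)$ (any combination of vertices and edges) are distinguished by some element of $S$. $\dim(G)$ and $\mathrm{mdim}(G)$ are the minimum cardinalities of a metric generator and of a mixed metric generator of $G$, respectively. *)

(* Defs.v *)
From HB Require Import structures.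
From mathcomp Require Import all_boot.

Set Implicit Arguments.
Unset Strict Implicit.
Unset Printing Implicit Defensive.

Notation cube d := {ffun 'I_d -> bool}.

Definition dist (d : nat) (u v : cube d) : nat := #|[set i | u i != v i]|.

Definition adj (d : nat) : rel (cube d) := [rel u v | dist u v == 1].

Definition edges (d : nat) : {set {set cube d}} :=
  [set A | [exists u, exists v, adj u v && (A == [set u; v])]].

Definition edge (d : nat) := {A : {set cube d} | A \in edges d}.

(* All distances are at most d, so the default value d of the minimum is
   harmless on nonempty A; see set_distE. *)
Definition set_dist (d : nat) (A : {set cube d}) (x : cube d) : nat :=
  \big[minn/d]_(u in A) dist u x.

Definition element (d : nat) := (cube d + edge d)%type.

Definition elt_dist (d : nat) (a : element d) (x : cube d) : nat :=
  match a with
  | inl u => dist u x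
  | inr e => set_dist (val e) x
  end.

Definition metric_generator (d : nat) (S : {set cube d}) : bool :=
  [forall u : cube d, forall v : cube d,
    (u != v) ==> [exists x in S, dist u x != dist v x]].

Definition mixed_metric_generator (d : nat) (S : {set cube d}) : bool :=
  [forall a : element d, forall b : element d,
    (a != b) ==> [exists x in S, elt_dist a x != elt_dist b x]].

(* The starting point setT of each arg min is itself a (mixed) metric
   generator, so these are genuine minima; see dimP and mdimP. *)
Definition dim (d : nat) : nat :=
  #|[arg min_(S < [set: cube d] | metric_generator S) #|S| ]|.

Definition mdim (d : nat) : nat :=
  #|[arg min_(S < [set: cube d] | mixed_metric_generator S) #|S| ]|.

HB.instance Definition _ := SemiGroup.isComLaw.Build nat minn minnA minnC.

Lemma dist_le (d : nat) (u v : cube d) : dist u v <= d.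
Proof. by rewrite /dist -[leqRHS]card_ord; apply: max_card. Qed.

Lemma distC (d : nat) (u v : cube d) : dist u v = dist v u.
Proof. by apply: eq_card => i; rewrite !inE eq_sym. Qed.

Lemma dist_eq0 (d : nat) (u v : cube d) : (dist u v == 0) = (u == v).
Proof.
rewrite /dist cards_eq0; apply/eqP/eqP => [uv0|->].
  apply/ffunP => i; apply/eqP; move/setP/(_ i): uv0.
  by rewrite !inE => /negbFE.
by apply/setP => i; rewrite !inE eqxx.
Qed.

Lemma set_distE (d : nat) (u v x : cube d) :
  set_dist [set u; v] x = minn (dist u x) (dist v x).
Proof.
rewrite /set_dist (bigD1 u) ?set21 //=; have [->|uv] := eqVneq u v.
  rewrite setUid big_pred0 ?minnn ?(minn_idPl (dist_le _ _)) // => y.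
  by rewrite inE andbN.
rewrite (big_pred1_id _ _ (i := v)) ?(minn_idPl (dist_le v x)) // => y.
by rewrite !inE; case: (eqVneq y u) => [->|_]; rewrite ?(negPf uv) ?andbT.
Qed.

Lemma set_dist_eq0 (d : nat) (e : edge d) (x : cube d) :
  (set_dist (val e) x == 0) = (x \in val e).
Proof.
case: e => A /=; rewrite inE => /existsP[u /existsP[v /andP[_ /eqP->]]].
rewrite set_distE !inE -(dist_eq0 x u) -(dist_eq0 x v) ![dist x _]distC.
by case: (dist u x) => [|m]; case: (dist v x) => [|n] //; rewrite minnSS.
Qed.

Lemma card_edge (d : nat) (e : edge d) : #|val e| = 2.
Proof.
case: e => A /=; rewrite inE => /existsP[u /existsP[v /andP[uv /eqP->]]].
rewrite cards2; case: eqVneq uv => //= ->.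
by rewrite /adj /= (eqP (_ : dist v v == 0)) // dist_eq0.
Qed.

Lemma metric_generatorT (d : nat) : metric_generator [set: cube d].
Proof.
apply/forallP => u; apply/forallP => v; apply/implyP => uv.
apply/existsP; exists u; rewrite inE /= (eqP (_ : dist u u == 0)) ?dist_eq0 //.
by rewrite eq_sym dist_eq0 eq_sym.
Qed.

Lemma mixed_metric_generatorT (d : nat) : mixed_metric_generator [set: cube d].
Proof.
pose supp (a : element d) : {set cube d} :=
  match a with inl u => [set u] | inr e => val e end.
have suppE a x : (elt_dist a x == 0) = (x \in supp a).
  by case: a => [u|e] /=; rewrite ?set_dist_eq0 // dist_eq0 inE eq_sym.
apply/forallP => a; apply/forallP => b; apply/implyP; apply: contraNT.
move/existsPn => ab.
have /setP : supp a =i supp b.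
  by move=> x; move: (ab x); rewrite inE /= negbK -!suppE => /eqP->.
case: a b {ab} => [u|e] [v|f] /= E.
- by rewrite (set1_inj E).
- by have := cards1 u; rewrite E (card_edge f).
- by have := cards1 v; rewrite -E (card_edge e).
- by rewrite (val_inj E).
Qed.

Lemma dimP (d : nat) :
  (exists2 S : {set cube d}, metric_generator S & #|S| = dim d) /\
  (forall S : {set cube d}, metric_generator S -> dim d <= #|S|).
Proof.
rewrite /dim; case: arg_minnP => [|S genS minS]; first exact: metric_generatorT.
by split; first exists S.
Qed.

Lemma mdimP (d : nat) :
  (exists2 S : {set cube d}, mixed_metric_generator S & #|S| = mdim d) /\
  (forall S : {set cube d}, mixed_metric_generator S -> mdim d <= #|S|).
Proof.
rewrite /mdim; case: arg_minnP => [|S genS minS].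
  exact: mixed_metric_generatorT.
by split; first exists S.
Qed.

(* Main.v *)
(* Write vertices as sign vectors and stack the elements of S as the rows of a
   matrix.  S is a metric generator iff no nonzero combination of the columns
   with coefficients in {-1, 0, 1} vanishes.  Since the distance from a vertex u
   to s has the parity of |u| + |s|, two edges of distinct directions i and j at
   equal distances from all of S force the columns i and j to agree up to sign,
   which is impossible; a vertex and an edge of direction i at equal distances
   from all of S force the column i to be constant.  Replacing some elements of
   S by their antipodes preserves metric generators, so it suffices to multiply
   the rows by signs forming a vector that is not a column up to sign.  Such a
   vector exists: for distinct a, b, c in S, the four sign vectors that are
   negative exactly on {}, {b, c}, {b} and {c} satisfy s1 + s2 = s3 + s4, so
   they cannot all be columns up to sign. *)
Require Import Defs.
From mathcomp Require Import all_boot.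

Set Implicit Arguments.
Unset Strict Implicit.
Unset Printing Implicit Defensive.

Lemma metric_generatorP (d : nat) (S : {set cube d}) :
  reflect (forall u v, {in S, dist u =1 dist v} -> u = v) (metric_generator S).
Proof.
apply: (iffP idP) => [genS u v uv | genS].
  move/forallP/(_ u)/forallP/(_ v): genS.
  case: eqVneq => //= _ /existsP[x /andP[xS]].
  by rewrite uv ?eqxx.
apply/forallP => u; apply/forallP => v; apply/implyP; apply: contraNT.
move/existsPn => uv; apply/eqP/genS => x xS; apply/eqP.
by have := uv x; rewrite xS negbK.
Qed.

Lemma unzip1_uniq_inj (T1 T2 : eqType) (r : seq (T1 * T2)) :
  uniq (unzip1 r) -> {in r &, injective fst}.
Proof.
elim: r => //= p r IHr /andP[/negP pr r_uniq] x y.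
rewrite !inE => /predU1P[->|xr] /predU1P[->|yr] // E; last exact: IHr.
  by case: pr; rewrite E map_f.
by case: pr; rewrite -E map_f.
Qed.

Lemma mixed_metric_generator_metric (d : nat) (S : {set cube d}) :
  mixed_metric_generator S -> metric_generator S.
Proof.
move=> /forallP genS; apply/forallP => u; apply/forallP => v.
exact: (forallP (genS (inl u)) (inl v)).
Qed.

Lemma dist_sum (d : nat) (u v : cube d) : dist u v = \sum_i (u i (+) v i).
Proof.
rewrite /dist -sum1_card big_mkcond; apply: eq_bigr => i _.
by rewrite inE; case: (u i); case: (v i).
Qed.

Lemma odd_dist (d : nat) (u v : cube d) :
  odd (dist u v) = odd (\sum_i u i) (+) odd (\sum_i v i).
Proof.
rewrite dist_sum !(big_morph odd oddD (erefl _)) -big_split.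
by apply: eq_bigr => i _; rewrite !oddb.
Qed.

Definition flip (d : nat) (i : 'I_d) (v : cube d) : cube d :=
  [ffun j => v j (+) (j == i)].

(** The endpoints differ only at [i], where exactly one of them agrees with [x]. The nearer endpoint
    thus pays only for the other coordinates. *)
Lemma set_dist_flip (d : nat) (i : 'I_d) (v x : cube d) :
  set_dist [set v; flip i v] x + (v i (+) x i) = dist v x.
Proof.
rewrite set_distE !dist_sum !(bigD1 (P := predT) i) //= !ffunE eqxx.
rewrite [X in minn _ (_ + X)](eq_bigr (fun j => nat_of_bool (v j (+) x j))).
  by case: (v i); case: (x i); rewrite ?addn0 ?add0n ?add1n ?addn1;
     rewrite ?(minn_idPl (leqnSn _)) ?(minn_idPr (leqnSn _)).
by move=> j /negPf ji; rewrite ffunE ji addbF.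
Qed.

Lemma edge_flip (d : nat) (e : edge d) :
  exists (v : cube d) i, v i = false /\ val e = [set v; flip i v].
Proof.
case: e => A /=; rewrite inE => /existsP[u /existsP[v /andP[uv /eqP->]]].
have [i uvE] := cards1P uv.
have vE : v = flip i u.
  apply/ffunP => j; rewrite ffunE; move/setP/(_ j): uvE; rewrite !inE => <-.
  by case: (u j); case: (v j).
have uE : u = flip i v.
  by apply/ffunP => j; rewrite vE !ffunE -addbA addbb addbF.
case ui: (u i); last by exists u, i; rewrite -vE.
by exists v, i; rewrite -uE setUC vE ffunE eqxx ui.
Qed.

Section Columns.
Variables (d : nat) (S : {set cube d}).
Hypothesis genS : metric_generator S.

(* A vanishing combination of the columns, the coefficient of the column p.1
   being -1 iff p.2 holds. *)
Lemma balanced_columns (r : seq ('I_d * bool)) : uniq (unzip1 r) ->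
    (forall x, x \in S -> (\sum_(p <- r) (p.2 (+) x p.1)).*2 = size r) ->
  r = [::].
Proof.
move=> r_uniq bal.
(* [w true] and [w false] mark the coefficients -1 and +1. Their distances to [x] differ by the
   signed sum at row [x], which vanishes for [x] in [S]. *)
pose w (b : bool) : cube d := [ffun i => (i, b) \in r].
have mem_r p b : p \in r -> ((p.1, b) \in r) = (b == p.2).
  case: p => i c icr; apply/idP/eqP => [ibr|-> //].
  by case: (unzip1_uniq_inj r_uniq ibr icr erefl).
have dist_w b x : dist (w b) x = \sum_(p <- r) ((b == p.2) (+) x p.1)
    + \sum_(i | i \notin unzip1 r) x i.
  rewrite dist_sum (bigID (mem (unzip1 r))) /= -big_uniq // big_map.
  congr (_ + _).
    by apply: eq_big_seq => p pr; rewrite ffunE mem_r.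
  apply: eq_bigr => i ir; rewrite ffunE; case ibr: (_ \in r) => //.
  by case/negP: ir; exact: (map_f fst ibr).
have /ffunP w01 : w true = w false.
  apply: (metric_generatorP _ genS) => x xS; rewrite !dist_w; congr (_ + _).
  have size_r : size r = \sum_(p <- r) (p.2 (+) x p.1)
      + \sum_(p <- r) ~~ (p.2 (+) x p.1).
    rewrite -sum1_size -big_split; apply: eq_bigr => p _.
    by case: (_ (+) _).
  have := bal x xS; rewrite size_r -addnn => /addnI E.
  transitivity (\sum_(p <- r) (p.2 (+) x p.1)); last rewrite E.
    by apply: eq_bigr => p _; case: p.2; case: (x _).
  by apply: eq_bigr => p _; case: p.2; case: (x _).
case E: r => [//|p r']; have pr : p \in r by rewrite E mem_head.
have := w01 p.1; rewrite !ffunE !mem_r //.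
by case: p.2.
Qed.

Lemma proportional_columns (i j : 'I_d) (c : bool) :
  {in S, forall x : cube d, x i (+) x j = c} -> i = j.
Proof.
move=> xij; apply: contraTeq isT => ij.
(* Column [i] is column [j] up to the sign given by [c]; the opposite sign on [j] makes the two
   cancel. *)
suff : [:: (i, false); (j, ~~ c)] = [::] by [].
apply: balanced_columns => [|x xS]; first by rewrite /= inE ij.
rewrite !big_cons big_nil -(xij x xS) /=.
by case: (x i); case: (x j).
Qed.

Lemma mixed_generator_of_nonconstant :
    (forall (i : 'I_d) c, ~ {in S, forall x : cube d, x i = c}) ->
  mixed_metric_generator S.
Proof.
move=> nonconst.
have vertex_edge u (e : edge d) : {in S, dist u =1 set_dist (val e)} -> False.
  have [v [i [vi ->]]] := edge_flip e => ue.
  (* Here [dist u x + x i = dist v x]; modulo 2 the coordinate sum of [x] cancels, leaving [x i]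
     equal to a constant. *)
  apply: (nonconst i (odd (\sum_i v i) (+) odd (\sum_i u i))) => x xS.
  have := congr1 odd (set_dist_flip i v x).
  rewrite vi -ue // oddD oddb !odd_dist /=.
  by do 3!case: (odd _); case: (x i).
apply/forallP => a; apply/forallP => b; apply/implyP; apply: contraNT.
move/existsPn => nab.
have {nab} ab : {in S, elt_dist a =1 elt_dist b}.
  by move=> x xS; apply/eqP; have := nab x; rewrite xS negbK.
case: a b ab => [u|e] [v|f] /= ab.
- by rewrite (metric_generatorP _ genS u v ab).
- by case: (vertex_edge u f).
- by case: (vertex_edge v e) => x xS; rewrite ab.
apply/eqP; congr inr; apply: val_inj.
have : forall x, x \in S -> set_dist (val e) x = set_dist (val f) x by [].
have [v [i [vi ->]]] := edge_flip e; have [w [j [wj ->]]] := edge_flip f => ef.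
have ij : i = j.
  apply: (@proportional_columns _ _ (odd (\sum_i v i) (+) odd (\sum_i w i))).
  move=> x xS; have := congr1 odd (set_dist_flip i v x).
  have := congr1 odd (set_dist_flip j w x).
  rewrite vi wj ef // !oddD !oddb !odd_dist /=.
  by do 4!case: (odd _); case: (x i); case: (x j).
rewrite -{j}ij in wj ef *.
(* With a common direction, the same correction [x i] turns both edge distances into vertex
   distances. *)
suff -> : v = w by [].
apply: (metric_generatorP _ genS) => x xS.
by rewrite -(set_dist_flip i v) -(set_dist_flip i w) vi wj ef.
Qed.

Lemma exists_non_column : 3 <= d -> exists sigma : cube d -> bool,
  forall (i : 'I_d) c, ~ {in S, forall x : cube d, x i (+) sigma x = c}.
Proof.
move=> hd.
(* With at most two rows, the bit [a i (+) b i] determines column [i] up to sign, so three columns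
   cannot be pairwise non-proportional. *)
have d_le2 (a b : cube d) : ~ {subset S <= [:: a; b]}.
  move=> Sab; suff inj : injective (fun i => a i (+) b i).
    by have := leq_card _ inj; rewrite card_ord card_bool leqNgt hd.
  move=> i j ab; apply: (@proportional_columns i j (a i (+) a j)) => x /Sab.
  rewrite !inE => /orP[]/eqP-> //.
  by move: ab; do 2!case: (a _); do 2!case: (b _).
have [a [b [c [[aS bS cS] [ab bc ca]]]]] : exists a b c : cube d,
    [/\ a \in S, b \in S & c \in S] /\ [/\ a != b, b != c & c != a].
  apply/card_gt2P; rewrite ltnNge cardE; apply/negP => leS.
  have SE x : (x \in S) = (x \in enum S) by rewrite mem_enum.
  case: (enum S) leS SE => [|a [|b [|//]]] _ SE.
  - by case: (d_le2 [ffun=> true] [ffun=> true]) => x; rewrite SE.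
  - by case: (d_le2 a a) => x; rewrite SE !inE => ->.
  - by case: (d_le2 a b) => x; rewrite SE.
pose column (s : cube d -> bool) (p : 'I_d * bool) :=
  [forall x in S, x p.1 (+) s x == p.2].
have columnP s p : column s p -> {in S, forall x : cube d, p.2 (+) x p.1 = s x}.
  move=> /forallP sp x xS; have := sp x; rewrite xS => /eqP<-.
  by case: (x p.1); case: (s x).
have nonP s : ~~ [exists p, column s p] -> forall (i : 'I_d) t,
    ~ {in S, forall x : cube d, x i (+) s x = t}.
  move/existsPn => ns i t it; have /negP[] := ns (i, t).
  by apply/forallP => x; apply/implyP => xS; rewrite /= it.
pose s1 := pred0 : pred (cube d); pose s2 := pred2 b c.
have [|/nonP] := boolP [exists p, column s1 p]; last by exists s1.
have [|/nonP] := boolP [exists p, column s2 p]; last by exists s2.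
have [|/nonP] := boolP [exists p, column (pred1 b) p]; last by exists (pred1 b).
have [|/nonP] := boolP [exists p, column (pred1 c) p]; last by exists (pred1 c).
move=> /existsP[p4 /columnP c4] /existsP[p3 /columnP c3].
move=> /existsP[p2 /columnP c2] /existsP[p1 /columnP c1].
(* Agreement at [a] fixes the sign: two of the vectors arising from one column would agree at [b]
   and [c] too. *)
have neq p q s t : {in S, forall x : cube d, p.2 (+) x p.1 = s x} ->
    {in S, forall x : cube d, q.2 (+) x q.1 = t x} ->
    s a = t a -> (s b, s c) != (t b, t c) -> p.1 != q.1.
  move=> sp tq sta; apply: contraNneq => pq.
  have pq2 : p.2 = q.2.
    by move: sta; rewrite -sp // -tq // pq => /addIb.
  by rewrite -!sp // -!tq // pq pq2.
(* Negating the last two signs encodes s1 + s2 - s3 - s4 = 0. *)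
suff : [:: p1; p2; (p3.1, ~~ p3.2); (p4.1, ~~ p4.2)] = [::] by [].
have ba : (b == a) = false by rewrite eq_sym (negPf ab).
have cb : (c == b) = false by rewrite eq_sym (negPf bc).
have simpE := (eqxx, negPf ab, ba, negPf bc, cb, negPf ca, eq_sym a c).
apply: balanced_columns => [|x xS].
  rewrite /= !inE !negb_or !andbT.
  rewrite (neq _ _ _ _ c1 c2) ?(neq _ _ _ _ c1 c3) ?(neq _ _ _ _ c1 c4) //=;
  rewrite ?(neq _ _ _ _ c2 c3) ?(neq _ _ _ _ c2 c4) ?(neq _ _ _ _ c3 c4) //=;
  by rewrite ?simpE.
rewrite !big_cons big_nil /= !addNb c1 // c2 // c3 // c4 //=.
by case: eqVneq => [->|_]; rewrite ?simpE //; case: eqVneq.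
Qed.

End Columns.

Definition antipode_if (d : nat) (sigma : cube d -> bool) (x : cube d) : cube d :=
  [ffun i => x i (+) sigma x].

Lemma dist_antipode_if (d : nat) (sigma : cube d -> bool) (u x : cube d) :
  dist u (antipode_if sigma x) = if sigma x then d - dist u x else dist u x.
Proof.
rewrite !dist_sum; under eq_bigr => i _ do rewrite ffunE.
case: (sigma x); last by apply: eq_bigr => i _; rewrite addbF.
have sum_d : \sum_i (u i (+) (x i (+) true)) + \sum_i (u i (+) x i) = d.
  rewrite -big_split -[RHS]card_ord -sum1_card; apply: eq_bigr => i _.
  by case: (u i); case: (x i).
by rewrite -[X in X - _]sum_d addnK.
Qed.

(** The distance to an antipode is [d] minus the original distance, so each determines the other. *)
Lemma metric_generator_antipode_if (d : nat) (sigma : cube d -> bool)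
    (S : {set cube d}) :
  metric_generator S -> metric_generator [set antipode_if sigma x | x in S].
Proof.
move=> /metric_generatorP genS; apply/metric_generatorP => u v uv.
apply: genS => x xS; have := uv _ (imset_f (antipode_if sigma) xS).
rewrite !dist_antipode_if; case: (sigma x) => // E.
by rewrite -(subKn (dist_le u x)) E subKn ?dist_le.
Qed.

Theorem theorem7 (d : nat) (hd : 3 <= d) : dim d = mdim d.
Proof.
have [[S genS cardS] min_dim] := dimP d.
have [[M genM cardM] min_mdim] := mdimP d.
apply/eqP; rewrite eqn_leq; apply/andP; split.
  by rewrite -cardM min_dim // mixed_metric_generator_metric.
rewrite -cardS.
have [sigma nonconst] := exists_non_column genS hd.
apply: leq_trans (leq_imset_card (antipode_if sigma) S); apply: min_mdim.
apply: mixed_generator_of_nonconstant => [|i c const].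
  exact: metric_generator_antipode_if.
(* A constant column [i] after the sign changes would make [sigma] equal to column [i] of [S] up to
   sign. *)
apply: (nonconst i c) => x xS.
by have := const _ (imset_f _ xS); rewrite ffunE.
Qed.
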